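(* Let $n,k,\alpha$ be positive integers with $k\ge3$ and $4\alpha-3n\ge1$, and put $r_4(n,k,\alpha)=4^{k-1}n-\frac{4^k-1}{3}\alpha$. (i) If $4r_4(n,k,\alpha)<k$, then there is no quaternary Hermitian LCD $[n,k,\alpha]$ code $C$ with $d(C^{\perp_H})\ge2$. (ii) Suppose $4r_4(n,k,\alpha)\ge k$. If there is no quaternary Hermitian LCD $[4r_4(n,k,\alpha),k,3r_4(n,k,\alpha)]$ code $C_0$ with $d(C_0^{\perp_H})\ge2$, then there is no quaternary Hermitian LCD $[n,k,\alpha]$ code $C$ with $d(C^{\perp_H})\ge2$.
   Context: $\mathbb{F}_4=\{0,1,\omega,\omega^2\}$ with $\omega^2=\omega+1$, $\overline{x}=x^2$. A quaternary $[n,k,d]$ code is a $k$-dimensional subspace of $\mathbb{F}_4^n$ with minimum nonzero Hamming weight $d(C)=d$. Its Hermitian dual is $C^{\perp_H}=\{x\in\mathbb{F}_4^n : \sum_i x_i\overline{y_i}=0\ \forall y\in C\}$, and $C$ is Hermitian LCD if $C\cap C^{\perp_H}=\{0\}$. *)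

(* Defs.v *)
From HB Require Import structures.
From mathcomp Require Export all_boot all_order all_algebra.

Set Implicit Arguments.
Unset Strict Implicit.
Unset Printing Implicit Defensive.

Import Order.TTheory GRing.Theory Num.Theory.

Local Open Scope ring_scope.

(* The definitions make sense over any finite field F; the conjugation
   x |-> x ^+ 2 is the intended one when #|F| = 4. *)

Definition hweight (F : finFieldType) (n : nat) (x : 'rV[F]_n) : nat :=
  #|[set i | x 0 i != 0]|.

(* Weights are at most n, so the default value n.+1 is only reached when A has
   no nonzero vector; it then plays the role of +oo. *)
Definition min_dist (F : finFieldType) (n : nat) (A : {pred 'rV[F]_n}) : nat :=
  \big[minn/n.+1]_(x in A | x != 0) hweight x.

Definition hdual (F : finFieldType) (n : nat) (C : {vspace 'rV[F]_n}) :
    {set 'rV[F]_n} :=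
  [set x : 'rV[F]_n | [forall (y : 'rV[F]_n | y \in C),
      \sum_(i < n) x 0 i * (y 0 i) ^+ 2 == 0]].

Definition hermitian_lcd (F : finFieldType) (n : nat)
    (C : {vspace 'rV[F]_n}) : Prop :=
  [set x : 'rV[F]_n in C] :&: hdual C = [set 0].

Definition is_code (F : finFieldType) (n k d : nat)
    (C : {vspace 'rV[F]_n}) : Prop :=
  \dim C = k /\ min_dist C = d.

(* The division by 3 is exact. The value may be negative, hence int. *)
Definition r4 (n k alpha : nat) : int :=
  (4 ^ k.-1 * n)%:Z - ((4 ^ k - 1) %/ 3 * alpha)%:Z.

(* Main.v *)
(* The columns of a generator matrix form a multiset of points of PG(k-1, 4),
   and the codewords correspond to hyperplanes. Summing the weights of the
   codewords whose hyperplane avoids a given point shows that every point occurs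
   at least s = 4 alpha - 3 n times. Removing s copies of every point, i.e. s
   copies of the simplex code, shortens the code to length 4 r4 and lowers every
   nonzero weight by s 4^(k-1), hence the minimum distance to 3 r4. For k >= 3
   the simplex code is Hermitian self-orthogonal, so the puncturing preserves
   the Hermitian form on C; nondegeneracy of the form then makes it injective on
   C, and the image is again LCD of dimension k. *)

From HB Require Import structures.
Require Import Defs.
From mathcomp Require Import all_boot all_order all_algebra all_field zify ring.

Set Implicit Arguments.
Unset Strict Implicit.
Unset Printing Implicit Defensive.

Import Order.TTheory GRing.Theory Num.Theory.

Local Open Scope ring_scope.

(* Makes the product of two finite abelian groups a [finZmodType]. *)
HB.saturate prod.

(** * Fibres of surjective additive maps between finite abelian groups *)

Section AdditiveSurjection.

Variables (U V : finZmodType) (f : U -> V).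
Hypothesis fD : {morph f : x y / x + y}.
Hypothesis f_surj : forall w, exists u, f u = w.

Lemma card_fiber_const w : #|[set u | f u == w]| = #|[set u | f u == 0]|.
Proof.
have [a fa] := f_surj w.
rewrite -(card_imset [set u | f u == 0] (addrI a)).
apply: eq_card => u; rewrite inE; apply/eqP/imsetP => [fu | [v]].
  exists (u - a); last by rewrite addrC subrK.
  by rewrite inE; apply/eqP/(addrI w); rewrite -{1}fa -fD addrC subrK fu addr0.
by rewrite inE => /eqP fv ->; rewrite fD fv fa addr0.
Qed.

Lemma card_fiber w : (#|[set u | f u == w]| * #|V| = #|U|)%N.
Proof.
rewrite -[#|U|]sum1_card (partition_big f predT) //=.
rewrite (eq_bigr (fun=> #|[set u | f u == w]|)) => [|v _].
  by rewrite sum_nat_const mulnC.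
rewrite card_fiber_const -(card_fiber_const v) -sum1_card.
by apply: eq_bigl => u; rewrite inE.
Qed.

Lemma card_preim_surj (P : pred V) :
  (#|[set u | P (f u)]| * #|V| = #|[set w | P w]| * #|U|)%N.
Proof.
rewrite -sum1_card (partition_big f P) /= => [|u]; last by rewrite inE.
rewrite big_distrl /= (eq_bigr (fun=> #|U|)) => [|w Pw].
  by rewrite sum_nat_const; congr (_ * _)%N; apply: eq_card => w; rewrite inE.
rewrite -(card_fiber w) -sum1_card; congr (_ * _)%N.
by apply: eq_bigl => u; rewrite !inE; case: eqP => [->|]; rewrite ?Pw ?andbF.
Qed.

(** All fibres have the size of the kernel. When that size is a multiple of [#|F|] and the values
    lie in [F], the sum vanishes. *)
Lemma sum_preim_surj (M : nmodType) (g : V -> M) :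
  \sum_u g (f u) = (\sum_w g w) *+ #|[set u | f u == 0]|.
Proof.
rewrite (partition_big f predT) //= -sumrMnl; apply: eq_bigr => w _.
rewrite -(card_fiber_const w) -sumr_const.
by apply: eq_big => u; rewrite ?inE // => /eqP ->.
Qed.

End AdditiveSurjection.

(** * The dot product on F^k: counts of non-orthogonal vectors and a vanishing Hermitian sum *)

Section DotProduct.

Variables (F : finFieldType) (k : nat).
Implicit Types (u v p q : 'rV[F]_k) (c : F).

Definition dot u v : F := \sum_i u 0 i * v 0 i.

Lemma dotC u v : dot u v = dot v u.
Proof. by apply: eq_bigr => i _; rewrite mulrC. Qed.

Lemma dotDl v : {morph dot^~ v : u1 u2 / u1 + u2}.
Proof.
by move=> u1 u2; rewrite -big_split; apply: eq_bigr => i _; rewrite mxE mulrDl.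
Qed.

Lemma dotZl c u v : dot (c *: u) v = c * dot u v.
Proof. by rewrite /dot big_distrr /=; apply: eq_bigr => i _; rewrite mxE mulrA. Qed.

Lemma dotZr c u v : dot u (c *: v) = c * dot u v.
Proof. by rewrite dotC dotZl dotC. Qed.

Lemma dot0r u : dot u 0 = 0.
Proof. by rewrite -(scale0r 0) dotZr mul0r. Qed.

Lemma dot_delta i v : dot (delta_mx 0 i) v = v 0 i.
Proof.
rewrite /dot (bigD1 i) //= big1 => [|j ji]; rewrite mxE !eqxx ?(negPf ji).
  by rewrite mul1r addr0.
by rewrite mul0r.
Qed.

Lemma rowV_neq0P v : reflect (exists i, v 0 i != 0) (v != 0).
Proof.
apply: (iffP idP) => [v0|[i vi]]; last by apply: contra vi => /eqP ->; rewrite mxE.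
apply/existsP; apply: contraR v0; rewrite negb_exists => /forallP v0.
by apply/eqP/rowP => i; rewrite mxE; apply/eqP; rewrite -[_ == _]negbK.
Qed.

Lemma dot_surj p : p != 0 -> forall a, exists u, dot u p = a.
Proof.
case/rowV_neq0P => i pi a; exists ((a / p 0 i) *: delta_mx 0 i).
by rewrite dotZl dot_delta divfK.
Qed.

Lemma dot_surj2 p q : p != 0 -> (forall c, q != c *: p) ->
  forall w : F * F, exists u, (dot u p, dot u q) = w.
Proof.
case/rowV_neq0P => i pi pq [a b].
(* Gaussian elimination with pivot [p 0 i]: what remains of [q] is nonzero at some [j]. This second
   pivot [m] makes the system solvable by a vector supported on [i] and [j]. *)
have /rowV_neq0P[j] : q - (q 0 i / p 0 i) *: p != 0 by rewrite subr_eq0.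
rewrite !mxE => mj; set m := q 0 j - _ in mj.
pose t := (b - a * (q 0 i / p 0 i)) / m.
exists (t *: delta_mx 0 j + ((a - t * p 0 j) / p 0 i) *: delta_mx 0 i).
rewrite !dotDl !dotZl !dot_delta; congr pair; first by field.
have -> : q 0 j = m + q 0 i / p 0 i * p 0 j by rewrite /m subrK.
by rewrite /t; field; apply/andP.
Qed.

Lemma card_rowV : #|{: 'rV[F]_k}| = (#|F| ^ k)%N.
Proof. by rewrite card_mx mul1n. Qed.

Lemma card_dot_neq0 p : p != 0 ->
  (#|[set u | dot u p != 0%R]| * #|F| = #|F|.-1 * #|F| ^ k)%N.
Proof.
move=> p0; rewrite -card_rowV.
rewrite (card_preim_surj (dotDl p) (dot_surj p0) (fun a => a != 0)).
by rewrite -(cardC1 (0 : F)); congr (_ * _)%N; apply: eq_card => a; rewrite !inE.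
Qed.

Let pairdotD p q : {morph (fun u => (dot u p, dot u q)) : u1 u2 / u1 + u2}.
Proof. by move=> u1 u2; rewrite !dotDl. Qed.

Lemma card_dot2_neq0 p q : p != 0 -> (forall c, q != c *: p) ->
  (#|[set u | (dot u p != 0%R) && (dot u q != 0%R)]| * #|F| ^ 2
   = #|F|.-1 ^ 2 * #|F| ^ k)%N.
Proof.
move=> p0 pq; rewrite -card_rowV -[(#|F| ^ 2)%N]mulnn -card_prod.
rewrite (card_preim_surj (V := (F * F)%type) (@pairdotD p q) (dot_surj2 p0 pq)
  (fun w => (w.1 != 0) && (w.2 != 0))).
rewrite -mulnn -(cardC1 (0 : F)); congr (_ * _)%N; rewrite -cardX.
by apply: eq_card => -[a b]; rewrite !inE.
Qed.

(** Translation by [x] permutes the field, so the sum of all elements is unchanged when [x] is added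
    to each of them. *)
Lemma mulrn_card (x : F) : x *+ #|F| = 0.
Proof.
have : \sum_(c : F) c = \sum_(c : F) (x + c) by apply: reindex_inj (addrI x).
by rewrite big_split /= sumr_const => /esym/(canRL (addrK _)); rewrite subrr.
Qed.

Lemma mulrn_dvd_card (x : F) m : (#|F| %| m)%N -> x *+ m = 0.
Proof. by case/dvdnP => t ->; rewrite mulnC mulrnA mulrn_card mul0rn. Qed.

(** Apart from the trivial case [u1 = 0], the summand factors through an additive surjection of [v]
    onto F or F * F, according to whether [u2] is a multiple of [u1]. Its kernel has |F|^(k-1) or
    |F|^(k-2) elements, a multiple of |F| since k >= 3. The case [e = 1] will give the
    self-orthogonality of the simplex code. *)
Lemma sum_dot_herm (e : nat) u1 u2 : (3 <= k)%N ->
  \sum_v dot u1 v * dot u2 v ^+ e.+1 = 0.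
Proof.
move=> k3; have q0 : (0 < #|F|)%N by apply/card_gt0P; exists 0.
have Ek : (#|F| ^ k = #|F| ^ 3 * #|F| ^ (k - 3))%N by rewrite -expnD subnKC.
have [->|u10] := eqVneq u1 0.
  by apply: big1 => v _; rewrite dotC dot0r mul0r.
have [/existsP[c /eqP ->]|] := boolP [exists c, u2 == c *: u1].
  rewrite (eq_bigr (fun v => (fun a => a * (c * a) ^+ e.+1) (dot v u1))).
    rewrite (sum_preim_surj (dotDl u1) (dot_surj u10)
      (fun a => a * (c * a) ^+ e.+1)).
    apply: mulrn_dvd_card; have := card_fiber (dotDl u1) (dot_surj u10) 0.
    rewrite card_rowV Ek !expnS => H.
    by apply/dvdnP; exists (#|F| * #|F| ^ (k - 3))%N; apply/eqP;
      rewrite -(eqn_pmul2r q0) H; apply/eqP; ring.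
  by move=> v _; rewrite dotZl dotC.
rewrite negb_exists => /forallP ind.
rewrite (eq_bigr (fun v => (fun w => w.1 * w.2 ^+ e.+1) (dot v u1, dot v u2))).
  rewrite (sum_preim_surj (V := (F * F)%type) (@pairdotD u1 u2) (dot_surj2 u10 ind)
    (fun w => w.1 * w.2 ^+ e.+1)).
  apply: mulrn_dvd_card.
  have := card_fiber (V := (F * F)%type) (@pairdotD u1 u2) (dot_surj2 u10 ind) 0.
  rewrite card_rowV card_prod Ek !expnS => H.
  by apply/dvdnP; exists (#|F| ^ (k - 3))%N; apply/eqP;
    rewrite -(eqn_pmul2r q0) -(eqn_pmul2r q0) -mulnA H; apply/eqP; ring.
by move=> v _; rewrite !(dotC v).
Qed.

End DotProduct.

(** * Columns as a multiset of projective points *)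

Section PointMultiset.

Variables (F : finFieldType) (k n : nat) (pt : 'I_n -> 'rV[F]_k).
Implicit Types (u v p : 'rV[F]_k) (j : 'I_n).

(** Requiring a nonzero scalar makes this an equivalence relation: its classes on nonzero vectors
    are the projective points, and 0 is a class of its own. *)
Definition collinear v p : bool := [exists c : F, (c != 0) && (v == c *: p)].

Lemma collinearP v p :
  reflect (exists2 c, c != 0 & v = c *: p) (collinear v p).
Proof.
by apply: (iffP existsP) => [[c /andP[c0 /eqP]]|[c c0 ->]]; exists c => //;
  rewrite c0 eqxx.
Qed.

Lemma collinear_sym v p : collinear v p = collinear p v.
Proof.
apply/collinearP/collinearP => -[c c0 ->]; exists c^-1; rewrite ?invr_eq0 //;
  by rewrite scalerA mulVf ?scale1r.
Qed.

Lemma collinear_trans v1 v2 v3 :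
  collinear v1 v2 -> collinear v2 v3 -> collinear v1 v3.
Proof.
move=> /collinearP[c c0 ->] /collinearP[d d0 ->]; apply/collinearP.
by exists (c * d); rewrite ?mulf_neq0 // scalerA.
Qed.

Lemma card_collinear p : p != 0 -> #|[set v | collinear p v]| = #|F|.-1.
Proof.
move=> p0; have inj_p : injective (fun c : F => c *: p).
  move=> c d /eqP; rewrite -subr_eq0 -scalerBl scaler_eq0 (negPf p0) orbF.
  by rewrite subr_eq0 => /eqP.
rewrite -(cardC1 (0 : F)) -(card_imset _ inj_p); apply: eq_card => v.
rewrite inE collinear_sym; apply/collinearP/imsetP => -[c].
  by move=> c0 ->; exists c.
by rewrite inE => c0 ->; exists c.
Qed.

(** For nonzero [p], the cardinality is the multiplicity of the point of [p] among the columns. *)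
Definition point_class p : {set 'I_n} := [set j | collinear (pt j) p].

(** Write q = |F| and average over the [u] not orthogonal to [p]. A column in the class of [p] is
    nonzero at all of them, an independent column at a fraction (q-1)/q, a zero column at none.
    Hence alpha <= m + (n-m)(q-1)/q, where m is the multiplicity. *)
Lemma point_class_mult_ge (alpha : nat) p :
  (forall u, u != 0 -> (alpha <= #|[set j | dot u (pt j) != 0%R]|)%N) ->
  p != 0 ->
  (#|F| * alpha <= #|F|.-1 * n + #|point_class p|)%N.
Proof.
move=> hwt p0; set m := #|point_class p|.
have q1 : (1 < #|F|)%N := finNzRing_gt1 F.
have le_mn : (m <= n)%N by rewrite -[n in (_ <= n)%N]card_ord max_card.
pose P := [set u | dot u p != 0].
pose c j := #|[set u | (dot u p != 0) && (dot u (pt j) != 0)]|.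
have double_count : (\sum_(u in P) #|[set j | dot u (pt j) != 0%R]| = \sum_j c j)%N.
  under eq_bigr do rewrite -sum1_card.
  rewrite (exchange_big_dep predT) //=; apply: eq_bigr => j _.
  by rewrite /c -sum1_card; apply: eq_bigl => u; rewrite !inE.
have lower : (#|P| * alpha <= \sum_j c j)%N.
  rewrite -double_count -sum_nat_const; apply: leq_sum => u; rewrite inE => up.
  by apply: hwt; apply: contraNneq up => ->; rewrite dotC dot0r.
(* The counts [c j] are multiplied by |F|^2 to avoid denominators. *)
have c_in j : j \in point_class p -> (c j * #|F| ^ 2 = #|F|.-1 * #|F| ^ k.+1)%N.
  rewrite inE => /collinearP[a a0 E].
  rewrite (expnS _ k) mulnCA -(card_dot_neq0 p0) mulnCA mulnn; congr (_ * _)%N.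
  by apply: eq_card => u; rewrite !inE E dotZr mulf_eq0 (negPf a0) andbb.
have c_out j : j \notin point_class p ->
    (c j * #|F| ^ 2 <= #|F|.-1 ^ 2 * #|F| ^ k)%N.
  rewrite inE => /collinearP np.
  have [pj0|pj0] := eqVneq (pt j) 0.
    rewrite /c (_ : [set u | _] = set0) ?cards0 //; apply/setP => u.
    by rewrite !inE pj0 dot0r eqxx andbF.
  rewrite card_dot2_neq0 // => a; apply/eqP => E; apply: np; exists a => //.
  by apply: contraNneq pj0 => a0; rewrite E a0 scale0r.
have upper : ((\sum_j c j) * #|F| ^ 2
    <= m * (#|F|.-1 * #|F| ^ k.+1) + (n - m) * (#|F|.-1 ^ 2 * #|F| ^ k))%N.
  rewrite big_distrl /= (bigID (mem (point_class p))) /=; apply: leq_add.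
    by rewrite (eq_bigr _ c_in) sum_nat_const.
  apply: (@leq_trans (\sum_(j | j \notin point_class p) #|F|.-1 ^ 2 * #|F| ^ k)%N).
    exact: leq_sum c_out.
  rewrite sum_nat_const leq_mul2r.
  rewrite (_ : #|_| = n - m)%N ?leqnn ?orbT //.
  by rewrite -[n in RHS]card_ord -(cardC (point_class p)) addKn; apply: eq_card.
have := leq_trans (leq_mul lower (leqnn (#|F| ^ 2))) upper.
have cP := card_dot_neq0 p0; rewrite -/P in cP.
have q0 : (0 < #|F|.-1 * #|F| ^ k)%N.
  by rewrite muln_gt0 expn_gt0 (ltnW q1) -subn1 subn_gt0 q1.
rewrite -(leq_pmul2l (n1 := (#|F| * alpha)%N) q0).
have -> : (#|P| * alpha * #|F| ^ 2 = #|F|.-1 * #|F| ^ k * (#|F| * alpha))%N.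
  by rewrite -cP; ring.
move=> H; apply: leq_trans H _.
rewrite (expnS _ k) -[X in (m * (_ * (X * _)))%N](prednK (ltnW q1)).
by rewrite -{2}(subnKC le_mn) eq_leq //; ring.
Qed.

Lemma transversal_exists s :
  (forall p, p != 0 -> (s <= #|point_class p|)%N) ->
  exists T : {set 'I_n}, forall p, p != 0 -> #|T :&: point_class p| = s.
Proof.
move=> hs.
(* A column is kept when it is among the first [s] of its own class. Collinear columns have the same
   class, so the choices agree. *)
exists [set j | j \in take s (enum (point_class (pt j)))] => p p0.
have -> : [set j | j \in take s (enum (point_class (pt j)))] :&: point_class p
    = [set j in take s (enum (point_class p))].
  apply/setP => j; rewrite !inE; have [jp|] := boolP (collinear (pt j) p).
    rewrite andbT (_ : point_class (pt j) = point_class p) //.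
    apply/setP => i; rewrite !inE; apply/idP/idP => ic.
      exact: collinear_trans ic jp.
    by apply: collinear_trans ic _; rewrite collinear_sym.
  move=> jp; rewrite andbF; apply/esym/negP => /mem_take.
  by rewrite mem_enum inE (negPf jp).
rewrite cardsE (card_uniqP (take_uniq _ (enum_uniq _))).
by rewrite size_take_min -cardE; apply/minn_idPl/hs.
Qed.

(** Spread each column of [T] over its |F|-1 nonzero multiples, on which [f] is constant: every
    nonzero vector is then reached exactly [s] times. *)
Lemma sum_transversal (M : nmodType) (f : 'rV[F]_k -> M) (T : {set 'I_n}) s :
  (forall j, pt j != 0) ->
  (forall c v, c != 0 -> f (c *: v) = f v) ->
  (forall p, p != 0 -> #|T :&: point_class p| = s) ->
  (\sum_(j in T) f (pt j)) *+ #|F|.-1 = (\sum_(v | v != 0) f v) *+ s.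
Proof.
move=> pt0 fZ hT; rewrite -!sumrMnl.
transitivity (\sum_(j in T) \sum_(v | collinear (pt j) v) f v).
  apply: eq_bigr => j _; rewrite -(card_collinear (pt0 j)) -sumr_const.
  apply: eq_big => v; first by rewrite inE.
  by rewrite inE => /collinearP[c c0 ->]; rewrite fZ.
rewrite (exchange_big_dep (fun v => v != 0)) /=.
  apply: eq_bigr => v v0; rewrite sumr_const -(hT v v0); congr (_ *+ _).
  by apply: eq_card => j; rewrite !inE.
move=> j v _ /collinearP[c _ E]; apply: contraNneq (pt0 j) => v0.
by rewrite E v0 scaler0.
Qed.

Lemma card_point_transversal (P : pred 'rV[F]_k) (T : {set 'I_n}) s :
  (forall j, pt j != 0) ->
  (forall c v, c != 0 -> P (c *: v) = P v) ->
  (forall p, p != 0 -> #|T :&: point_class p| = s) ->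
  (#|[set j in T | P (pt j)]| * #|F|.-1 = s * #|[set v | (v != 0%R) && P v]|)%N.
Proof.
move=> pt0 PZ hT.
have card_sum (I : finType) (Q R : pred I) :
    #|[set i | Q i && R i]| = (\sum_(i | Q i) (R i : nat))%N.
  by rewrite -sum1dep_card big_mkcondr; apply: eq_bigr => i _; case: (R i).
have PZn c v : c != 0 -> (P (c *: v) : nat) = P v by move=> c0; rewrite PZ.
have := sum_transversal (M := nat) pt0 PZn hT.
by rewrite -[LHS]mulr_natr -[RHS]mulr_natr !natn !card_sum [RHS]mulnC.
Qed.

End PointMultiset.

(** * Minimum distance, and dual distance at least 2 *)

Section MinimumDistance.

Variables (F : finFieldType) (n : nat).
Implicit Types (A : {pred 'rV[F]_n}) (C : {vspace 'rV[F]_n}) (x y : 'rV[F]_n).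

Lemma min_dist_le A x : x \in A -> x != 0 -> (min_dist A <= hweight x)%N.
Proof.
move=> xA x0; rewrite /min_dist.
have : x \in index_enum 'rV[F]_n by exact: mem_index_enum.
elim: (index_enum _) => // y r IHr; rewrite inE big_cons => /orP[/eqP<-|xr].
  by rewrite xA x0 geq_minl.
by case: ifP => _; rewrite ?geq_min IHr ?orbT.
Qed.

(** The bound [m <= n.+1] handles the default value of an empty minimum. *)
Lemma leq_min_dist A m : (m <= n.+1)%N ->
  (forall x, x \in A -> x != 0 -> (m <= hweight x)%N) -> (m <= min_dist A)%N.
Proof.
move=> mn hA; rewrite /min_dist.
apply: (big_ind (fun d => (m <= d)%N)) => // [d1 d2 h1 h2|x /andP[xA x0]].
  by rewrite leq_min h1.
exact: hA.
Qed.

Lemma hweight_le x : (hweight x <= n)%N.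
Proof. by rewrite -[n in (_ <= n)%N]card_ord max_card. Qed.

Lemma min_dist_attained A x : x \in A -> x != 0 ->
  exists y, [/\ y \in A, y != 0 & hweight y = min_dist A].
Proof.
move=> xA x0; case: (arg_minnP (@hweight F n) (P := fun y => (y \in A) && (y != 0))
  (i0 := x)); first by rewrite xA.
move=> y /andP[yA y0] ymin; exists y; split=> //; apply/eqP.
rewrite eqn_leq min_dist_le // andbT leq_min_dist // => [|z zA z0].
  exact: leq_trans (hweight_le y) _.
by apply: ymin; rewrite zA.
Qed.

Lemma hdualP C x :
  reflect (forall y, y \in C -> \sum_i x 0 i * y 0 i ^+ 2 = 0) (x \in hdual C).
Proof.
rewrite inE; apply: (iffP forallP) => hx y; last first.
  by apply/implyP => yC; apply/eqP/hx.
by move=> yC; apply/eqP; have := hx y; rewrite yC.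
Qed.

(** A word of weight 1 supported at [j] is in the dual exactly when coordinate [j] vanishes on [C].
    For [n = 0] the default value would be 1, hence [0 < n]. *)
Lemma hdual_min_dist_ge2P C : (0 < n)%N ->
  (2 <= min_dist (hdual C))%N <-> forall j, exists2 x, x \in C & x 0 j != 0.
Proof.
move=> n0; split=> [d2 j | hC].
  have [/existsP[x /andP[xC xj]]|] := boolP [exists x, (x \in C) && (x 0 j != 0)].
    by exists x.
  rewrite negb_exists => /forallP hj.
  have eC : delta_mx 0 j \in hdual C.
    apply/hdualP => y yC; have /nandP[/negP//|/negPn/eqP yj] := hj y.
    apply: big1 => i _; rewrite mxE eqxx.
    by have [->|] := eqVneq i j; rewrite ?yj ?expr0n ?mulr0 ?mul0r.
  have e0 : delta_mx 0 j != 0 :> 'rV[F]_n.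
    by apply/rowV_neq0P; exists j; rewrite mxE !eqxx oner_eq0.
  have := leq_trans d2 (min_dist_le eC e0).
  rewrite /hweight (_ : [set i | _] = [set j]) ?cards1 //.
  by apply/setP => i; rewrite !inE mxE eqxx /=; case: (i == j); rewrite ?oner_eq0 ?eqxx.
apply: leq_min_dist => // x /hdualP xC /rowV_neq0P[j xj].
rewrite ltnNge; apply/negP => wx.
have [y yC yj] := hC j; have := xC y yC; rewrite (bigD1 j) //= big1 => [|i ij].
  by move/eqP; rewrite addr0 mulf_eq0 expf_eq0 (negPf xj) (negPf yj).
apply/eqP; rewrite mulf_eq0; apply/orP; left; apply: contraTT wx => xi.
rewrite -ltnNge; apply: (@leq_trans #|[set i; j]|); first by rewrite cards2 ij.
by apply: subset_leq_card; apply/subsetP => l; rewrite !inE => /orP[]/eqP->.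
Qed.

End MinimumDistance.

(** * Projection of words onto a set of coordinates *)

Section Puncturing.

Variables (F : finFieldType) (n : nat) (A : {set 'I_n}).

(** The set [A] holds the coordinates that are kept, not the deleted ones. *)
Definition puncture : 'Hom('rV[F]_n, 'rV[F]_#|A|) :=
  linfun (colsub (@enum_val _ (mem A))).

Lemma punctureE x i : puncture x 0 i = x 0 (enum_val i).
Proof. by rewrite lfunE mxE. Qed.

Lemma sum_puncture (M : nmodType) (g : F -> F -> M) x y :
  \sum_i g (puncture x 0 i) (puncture y 0 i) = \sum_(j in A) g (x 0 j) (y 0 j).
Proof. by rewrite [RHS]big_enum_val; apply: eq_bigr => i _; rewrite !punctureE. Qed.

Lemma hweight_puncture x :
  hweight (puncture x) = #|[set j in A | x 0 j != 0]|.
Proof.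
rewrite /hweight -(card_imset _ (@enum_val_inj _ (mem A))).
apply: eq_card => j; rewrite !inE; apply/imsetP/andP => [[i]|[jA xj]].
  by rewrite inE punctureE => xi ->; split=> //; apply: enum_valP.
exists (enum_rank_in jA j); last by rewrite enum_rankK_in.
by rewrite inE punctureE enum_rankK_in.
Qed.

End Puncturing.

(** * Removing copies of the simplex code from a quaternary code *)

Section ResidualCode.

Variables (F : finFieldType) (hF : #|F| = 4%N) (n : nat) (C : {vspace 'rV[F]_n}).

(** Columns of the generator matrix with rows [vbasis C]; [codeword] is the corresponding
    encoder. *)
Let col (j : 'I_n) : 'rV[F]_(\dim C) := \row_i (vbasis C)`_i 0 j.

Let codeword (u : 'rV[F]_(\dim C)) : 'rV[F]_n := \sum_i u 0 i *: (vbasis C)`_i.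

Let codewordE u j : codeword u 0 j = dot u (col j).
Proof. by rewrite summxE; apply: eq_bigr => i _; rewrite !mxE. Qed.

Let codeword_in u : codeword u \in C.
Proof.
apply: memv_suml => i _; apply/memvZ/vbasis_mem/mem_nth.
by rewrite size_tuple.
Qed.

Let codeword_surj x : x \in C -> exists u, x = codeword u.
Proof.
move=> xC; exists (\row_i coord (vbasis C) i x).
by rewrite {1}(coord_vbasis xC); apply: eq_bigr => i _; rewrite mxE.
Qed.

Let codeword_neq0 u : u != 0 -> codeword u != 0.
Proof.
apply: contraNneq => cu0; apply/eqP/rowP => i; rewrite mxE.
by move/freeP: (basis_free (vbasisP C)) => /(_ (fun i => u 0 i)); apply.
Qed.

(** Since 4x = 0, 3x = -x. This cancels the factor [#|F|.-1] of [sum_transversal]. *)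
Let mulrn3_eq0 (x : F) : x *+ 3 = 0 -> x = 0.
Proof.
by move=> x3; rewrite -[x]addr0 -x3 -mulrS -hF mulrn_card.
Qed.

(* T consists of s columns in each class of proportional columns, that is, of
   s copies of the generator matrix of a simplex code. *)
Lemma simplex_columns alpha s : (3 <= \dim C)%N ->
  (4 * alpha = 3 * n + s)%N -> min_dist C = alpha ->
  (forall j, exists2 x, x \in C & x 0 j != 0) ->
  exists T : {set 'I_n}, [/\ (3 * #|T| = s * (4 ^ \dim C - 1))%N,
    forall x, x \in C -> x != 0 ->
      #|[set j in T | x 0 j != 0]| = (s * 4 ^ (\dim C).-1)%N
    & forall x y, x \in C -> y \in C ->
      \sum_(j in T) x 0 j * y 0 j ^+ 2 = 0].
Proof.
move=> k3 hs hd hC.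
have col0 j : col j != 0.
  have [x /codeword_surj[u ->]] := hC j; rewrite codewordE => uj.
  by apply: contraNneq uj => ->; rewrite dot0r.
have [|T hT] := @transversal_exists F _ n col s.
  (* After adding [3 * n] to both sides, [hs] turns the goal into the multiplicity bound at |F| =
     4. *)
  move=> p p0; rewrite -(leq_add2l (3 * n)) -hs -[4%N]hF -[3%N]/(4.-1) -[in 4.-1]hF.
  apply: point_class_mult_ge p0 => u u0; rewrite -hd.
  apply: leq_trans (min_dist_le (codeword_in u) (codeword_neq0 u0)) _.
  by apply: subset_leq_card; apply/subsetP => j; rewrite !inE codewordE.
exists T; split.
- have := card_point_transversal (P := predT) col0 (fun _ _ _ => erefl) hT.
  rewrite hF (_ : [set j in T | _] = T); last by apply/setP => j; rewrite !inE andbT.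
  rewrite mulnC => ->; congr (_ * _)%N.
  rewrite subn1 -hF -card_rowV -(cardC1 (0 : 'rV[F]_(\dim C))).
  by apply: eq_card => v; rewrite !inE andbT.
- move=> x /codeword_surj[u ->] x0.
  have u0 : u != 0.
    by apply: contraNneq x0 => ->; apply/eqP; apply: big1 => i _; rewrite mxE scale0r.
  have PZ c v : c != 0 -> (dot u (c *: v) != 0) = (dot u v != 0).
    by move=> c0; rewrite dotZr mulf_eq0 (negPf c0).
  have := card_point_transversal (P := fun v => dot u v != 0) col0 PZ hT.
  rewrite (_ : [set v | _ && _] = [set v | dot v u != 0]); last first.
    apply/setP => v; rewrite !inE dotC andbC; case: eqVneq => //= vu.
    by apply: contraNneq vu => ->; rewrite dotC dot0r.
  have := card_dot_neq0 u0; rewrite hF => E1 E2.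
  have Dk : (4 ^ \dim C = 4 * 4 ^ (\dim C).-1)%N by rewrite -expnS prednK //; lia.
  have -> : [set j in T | codeword u 0 j != 0] = [set j in T | dot u (col j) != 0].
    by apply/setP => j; rewrite !inE codewordE.
  have E3 : #|[set v | dot v u != 0%R]| = (3 * 4 ^ (\dim C).-1)%N by lia.
  apply/eqP; rewrite -(eqn_pmul2r (m := 3)) // E2 E3; apply/eqP; ring.
- move=> x y /codeword_surj[u ->] /codeword_surj[w ->].
  apply: mulrn3_eq0; have := sum_transversal (f := fun v => dot u v * dot w v ^+ 2) col0 _ hT.
  rewrite hF /= => E; under eq_bigr do rewrite !codewordE; rewrite E.
    have := sum_dot_herm 1 u w k3.
    by rewrite (bigD1 0) //= dot0r mul0r add0r => ->; rewrite mul0rn.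
  (* The Hermitian summand is invariant under scaling: the factor is c * c^2 = c^3 = 1, because c^4
     = c in F. *)
  move=> c v c0; rewrite !dotZr exprMn mulrACA -exprS.
  suff -> : c ^+ 3 = 1 by rewrite mul1r.
  by apply: (mulfI c0); rewrite -exprS -hF expf_card mulr1.
Qed.

Lemma residual_code alpha s : (3 <= \dim C)%N ->
  (4 * alpha = 3 * n + s)%N -> min_dist C = alpha -> hermitian_lcd C ->
  (2 <= min_dist (hdual C))%N ->
  exists n0 d0, [/\ (3 * n0 + s * (4 ^ \dim C - 1) = 3 * n)%N,
    (d0 + s * 4 ^ (\dim C).-1 = alpha)%N, (\dim C <= n0)%N
    & exists C0 : {vspace 'rV[F]_n0}, [/\ is_code (\dim C) d0 C0,
       hermitian_lcd C0 & (2 <= min_dist (hdual C0))%N]].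
Proof.
move=> k3 hs hd lcd dual2.
have n0 : (0 < n)%N.
  have := dimvS (subvf C); rewrite dimvf /dim /= mul1n; lia.
have hC := (hdual_min_dist_ge2P C n0).1 dual2.
have [T [cardT wtT hermT]] := simplex_columns k3 hs hd hC.
pose pi := puncture F (~: T).
(* The coordinates in [T] contribute 0 to the form, so a word whose projection is orthogonal to the
   projected code is already orthogonal to [C]. This yields both injectivity of [pi] on [C] and the
   LCD property of the image. *)
have lcd0 x : x \in C -> (forall y, y \in C -> \sum_i pi x 0 i * pi y 0 i ^+ 2 = 0) ->
    x = 0.
  move=> xC hx; apply/eqP; rewrite -in_set1 -lcd in_setI [in X in X && _]inE xC.
  apply/hdualP => y yC.
  rewrite (bigID (mem T)) /= hermT // add0r -[RHS](hx y yC).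
  rewrite (sum_puncture _ (fun a b => a * b ^+ 2)).
  by apply: eq_bigl => j; rewrite inE.
have pi_inj x : x \in C -> pi x = 0 -> x = 0.
  move=> xC pix; apply: lcd0 => // y _; apply: big1 => i _.
  by rewrite pix mxE mul0r.
have dimC0 : \dim (pi @: C) = \dim C.
  apply: limg_dim_eq; apply/eqP; rewrite -subv0; apply/subvP => x.
  by rewrite memv_cap memv_ker memv0 => /andP[xC /eqP/(pi_inj _ xC)->].
have wt0 x : x \in C -> x != 0 -> (hweight (pi x) + s * 4 ^ (\dim C).-1 = hweight x)%N.
  move=> xC x0; rewrite -(wtT x xC x0) hweight_puncture addnC.
  rewrite /hweight -(cardsID T [set i | x 0 i != 0]).
  by congr (_ + _)%N; apply: eq_card => j; rewrite !inE // andbC.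
(* All nonzero weights drop by the same amount, so a minimum weight word of [C] projects to one of
   the image. *)
have [x0 [x0C x00 wx0]] : exists y, [/\ y \in C, y != 0 & hweight y = min_dist C].
  have Cn0 : C != 0%VS by rewrite -dimv_eq0; case: (\dim C) k3.
  by apply: (min_dist_attained (x := vpick C)); rewrite ?memv_pick ?vpick0.
have pix0 : pi x0 != 0 by apply: contraNneq x00 => /(pi_inj _ x0C)->.
have dk : (\dim C <= #|~: T|)%N.
  by rewrite -dimC0; have := dimvS (subvf (pi @: C)); rewrite dimvf /dim /= mul1n.
exists #|~: T|, (hweight (pi x0)); split=> //.
- have := cardsC T; rewrite card_ord; lia.
- by rewrite wt0 // wx0.
exists (pi @: C)%VS; split.
- split=> //; apply/eqP; rewrite eqn_leq min_dist_le ?memv_img //=.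
  apply: leq_min_dist; first exact: leq_trans (hweight_le _) _.
  move=> y /memv_imgP[x xC ->] pix.
  have x_n0 : x != 0 by apply: contraNneq pix => ->; rewrite linear0.
  rewrite -(leq_add2r (s * 4 ^ (\dim C).-1)) !wt0 // wx0.
  exact: min_dist_le.
- apply/setP => y; rewrite in_setI in_set1 [in X in X && _]inE; apply/andP/eqP => [[]|->]; last first.
    rewrite mem0v; split=> //; apply/hdualP => z _; apply: big1 => i _.
    by rewrite mxE mul0r.
  move=> /memv_imgP[x xC ->] /hdualP hx.
  rewrite (lcd0 x xC) ?linear0 // => z zC; apply: hx; exact: memv_img.
(* Each remaining coordinate is a coordinate of [C], hence not identically zero on the image; the
   length is positive because it is at least [\dim C]. *)
- apply/hdual_min_dist_ge2P => [|i]; first by lia.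
  have [x xC xi] := hC (enum_val i); exists (pi x); first exact: memv_img.
  by rewrite punctureE.
Qed.

End ResidualCode.

(** * Parameters of the residual code in terms of [r4], and nonexistence *)

Theorem theorem3p4 (F : finFieldType) (hF : #|F| = 4%N) (n k alpha : nat)
    (hn : (0 < n)%N) (hk : (3 <= k)%N) (halpha : (0 < alpha)%N)
    (h : 1 <= 4 * alpha%:Z - 3 * n%:Z) :
  (4 * r4 n k alpha < k%:Z ->
     ~ exists C : {vspace 'rV[F]_n},
         [/\ is_code k alpha C, hermitian_lcd C
           & (2 <= min_dist (hdual C))%N])
  /\
  (k%:Z <= 4 * r4 n k alpha ->
     (~ exists C0 : {vspace 'rV[F]_(4 * `|r4 n k alpha|)},
         [/\ is_code k (3 * `|r4 n k alpha|) C0, hermitian_lcd C0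
           & (2 <= min_dist (hdual C0))%N]) ->
     ~ exists C : {vspace 'rV[F]_n},
         [/\ is_code k alpha C, hermitian_lcd C
           & (2 <= min_dist (hdual C))%N]).
Proof.
(* A single construction gives both parts: the length bound contradicts the hypothesis of (i), the
   residual code that of (ii). *)
suff key (C : {vspace 'rV[F]_n}) :
    is_code k alpha C -> hermitian_lcd C -> (2 <= min_dist (hdual C))%N ->
  k%:Z <= 4 * r4 n k alpha /\
  exists C0 : {vspace 'rV[F]_(4 * `|r4 n k alpha|)},
         [/\ is_code k (3 * `|r4 n k alpha|) C0, hermitian_lcd C0
           & (2 <= min_dist (hdual C0))%N].
  split=> [lt_rk [C [c1 c2 c3]]|_ noC0 [C [c1 c2 c3]]].
    by have [] := key C c1 c2 c3; rewrite leNgt lt_rk.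
  by apply: noC0; have [] := key C c1 c2 c3.
move=> [dimC dC] lcd dual2; rewrite -dimC in hk *.
have hs : (4 * alpha = 3 * n + (4 * alpha - 3 * n))%N by lia.
have [n0 [d0 [En Ed le_kn0 C0]]] := residual_code hF hk hs dC lcd dual2.
(* With K = 4^(k-1), 3t = 4^k - 1 and s = 4 alpha - 3n, one has n0 = n - st = 4(Kn - t alpha) and d0
   = alpha - sK = 3(Kn - t alpha). Nonnegativity of [r4] follows from that of [n0]. *)
have [Er Er' Er0] : [/\ n0 = (4 * `|r4 n (\dim C) alpha|)%N,
    d0 = (3 * `|r4 n (\dim C) alpha|)%N & 0 <= r4 n (\dim C) alpha].
  have Dk : (4 ^ \dim C = 4 * 4 ^ (\dim C).-1)%N by rewrite -expnS prednK //; lia.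
  have /dvdnP[t Et] : (3 %| 4 ^ \dim C - 1)%N by rewrite subn1 predn_exp dvdn_mulr.
  rewrite /r4 Et mulnK //; rewrite Et in En.
  set K := (4 ^ (\dim C).-1)%N in Dk Ed *; set s := (4 * alpha - 3 * n)%N in hs En Ed.
  have K0 : (0 < K)%N by rewrite expn_gt0.
  have Et' : (4 * K = 3 * t + 1)%N by lia.
  (* The next four identities supply the products that [lia] treats as atoms. *)
  have Htn : (4 * K * n = 3 * t * n + n)%N by rewrite Et'; ring.
  have Hta : (4 * K * alpha = 3 * t * alpha + alpha)%N by rewrite Et'; ring.
  have Hst : (t * (4 * alpha) = t * (3 * n) + t * s)%N by rewrite hs; ring.
  have HsK : (K * (4 * alpha) = K * (3 * n) + K * s)%N by rewrite hs; ring.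
  have E1 : (n0 + 4 * (t * alpha) = 4 * (K * n))%N by lia.
  have E2 : (d0 + 3 * (t * alpha) = 3 * (K * n))%N by lia.
  by split; lia.
rewrite -Er -Er'; split=> //.
lia.
Qed.
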